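(* Let $\lambda_1<\dots<\lambda_n$ be an AP-free spectrum. There exist $C>0$ and $K>0$ such that for every $T_0\in\mathcal{T}_\Lambda$ whose Wilkinson iterates $T_k=\mathbf{W}^k(T_0)$ are defined for all $k$: (a) if $k>K$ then $|(T_{k+1})_{n,n-1}|<1/C$ and $|(T_{k+1})_{n,n-1}|\le C|(T_k)_{n,n-1}|^2$; (b) the set of positive integers $k$ for which $|(T_{k+1})_{n,n-1}|>C|(T_k)_{n,n-1}|^3$ has at most $K$ elements.
   Context: A spectrum is AP-free if no eigenvalue is the average of two others (it contains no 3-term arithmetic progression). $\Lambda=\mathrm{diag}(\lambda_1,\dots,\lambda_n)$ and $\mathcal{T}_\Lambda$ is the set of real symmetric tridiagonal $n\times n$ matrices with spectrum $\{\lambda_1,\dots,\lambda_n\}$. For $T\in\mathcal{T}_\Lambda$, Wilkinson's shift $\omega(T)$ is the eigenvalue of the bottom $2\times 2$ principal block of $T$ closest to $T_{n,n}$ (well defined unless $T_{n,n}=T_{n-1,n-1}$). Wilkinson's step is $\mathbf{W}(T)=Q^*TQ$ where $T-\omega(T)I=QR$, $Q$ orthogonal, $R$ upper triangular with positive diagonal; it is defined when $T_{n,n}\ne T_{n-1,n-1}$ and $\omega(T)$ is not an eigenvalue of $T$, and extended by continuity to matrices with $T_{n,n-1}=0$, $T_{n,n}\neq T_{n-1,n-1}$. *)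

(* Defs.v *)
From HB Require Import structures.
From mathcomp Require Import all_boot all_order all_algebra.
From mathcomp Require Import reals.
Set Implicit Arguments. Unset Strict Implicit. Unset Printing Implicit Defensive.
Import Order.TTheory GRing.Theory Num.Theory.
Local Open Scope ring_scope.

(* Matrices have dimension n.+2 (i.e. N = n+2 >= 2), indices 0 .. n+1.
   Paper index N   <-> ord_max,  paper index N-1 <-> inord n. *)
Section Wilkinson.
Variables (R : realType) (n : nat).
Local Notation M := 'M[R]_n.+2.

Definition lastI : 'I_n.+2 := ord_max.
Definition penI : 'I_n.+2 := inord n.

Definition ap_free (lam : 'I_n.+2 -> R) : Prop :=
  forall i j k : 'I_n.+2, i != j -> i != k -> j != k ->
    lam i != (lam j + lam k) / 2%:R.

Definition symmetric_mx (T : M) : Prop := T^T = T.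

Definition tridiagonal (T : M) : Prop :=
  forall i j : 'I_n.+2, (i.+1 < j)%N || (j.+1 < i)%N -> T i j = 0.

Definition has_spectrum (T : M) (lam : 'I_n.+2 -> R) : Prop :=
  forall a : R, eigenvalue T a <-> exists i, a = lam i.

Definition in_TLambda (lam : 'I_n.+2 -> R) (T : M) : Prop :=
  symmetric_mx T /\ tridiagonal T /\ has_spectrum T lam.

Definition subd (T : M) : R := T lastI penI.

(* Wilkinson's shift: the eigenvalue of the bottom 2x2 block
   [[a, b], [b, c]] closest to c = T_{N,N}; its eigenvalues are m +- s. *)
Definition wshift (T : M) : R :=
  let a := T penI penI in
  let c := T lastI lastI in
  let b := T lastI penI in
  let m := (a + c) / 2%:R in
  let s := Num.sqrt (((a - c) / 2%:R) ^+ 2 + b ^+ 2) in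
  if `|m + s - c| < `|m - s - c| then m + s else m - s.

Definition orthogonal_mx (Q : M) : Prop := Q^T *m Q = 1%:M.

Definition upper_triangular (Rm : M) : Prop :=
  forall i j : 'I_n.+2, (j < i)%N -> Rm i j = 0.

(* T' = W(T).  Generic case: T_{N,N} <> T_{N-1,N-1}, omega(T) not an
   eigenvalue, T - omega I = Q R with Q orthogonal, R upper triangular with
   positive diagonal, T' = Q^T T Q.
   Continuity extension (T_{N,N-1} = 0, T_{N,N} <> T_{N-1,N-1}): same
   formula where only the first N-1 diagonal entries of R are required to
   be positive (then R_{N,N} = 0, Q = Q' (+) (+-1)). *)
Definition wilkinson_step (T T' : M) : Prop :=
  T lastI lastI != T penI penI /\
  ( (~ eigenvalue T (wshift T) /\
     exists Q Rm : M, orthogonal_mx Q /\ upper_triangular Rm /\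
       (forall i, 0 < Rm i i) /\
       T - (wshift T)%:M = Q *m Rm /\ T' = Q^T *m T *m Q)
  \/ (subd T = 0 /\
     exists Q Rm : M, orthogonal_mx Q /\ upper_triangular Rm /\
       (forall i, i != lastI -> 0 < Rm i i) /\
       T - (wshift T)%:M = Q *m Rm /\ T' = Q^T *m T *m Q)).

End Wilkinson.

(* Main.v *)
(* In eigen-coordinates a step is inverse iteration on the last column of the
   orthogonal diagonalizer: the unit vector x with T e_N = x becomes x' with
   (lam_i - w) x'_i = tau x_i, and b = T_{N,N-1} satisfies
   b^2 = sum_i (lam_i - c)^2 x_i^2 with c = T_{N,N}.
   - If p is the characteristic polynomial of the bottom block, the quantity
     b^2 * |p(Lambda) x|^2 (that is, b_{N-1}^4 b_{N-2}^2) is at least halved by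
     each step, as in the Hoffmann-Parlett convergence proof, so b becomes
     small after a number of steps bounded in terms of the spectrum alone.
   - Then x is trapped near some eigenvector e_i. Since |w - c| <= |b|, one step
     gives b' = O(b^2); if moreover T_{N-1,N-1} stays away from T_{N,N}, then
     |w - c| = O(b^2) and b' = O(b^3).
   - T_{N-1,N-1} is close to an average of the lam_j, j <> i, weighted by
     (lam_j - lam_i)^2 x_j^2. A noncubic step therefore needs two modes
     j, l <> i with comparable x_j^2 and x_l^2. As the spectrum is AP-free,
     |lam_j - lam_i| <> |lam_l - lam_i|, and the ratio x_j^2 / x_l^2 is
     multiplied at each step by a factor bounded away from 1: each pair
     can be comparable only during boundedly many steps. *)
Require Import Defs.
From HB Require Import structures.
From mathcomp Require Import all_boot all_order all_algebra.
From mathcomp Require Import boolp reals.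
From mathcomp Require Import ring lra.
Set Implicit Arguments. Unset Strict Implicit. Unset Printing Implicit Defensive.
Import Order.TTheory GRing.Theory Num.Theory.
Local Open Scope ring_scope.

(** * Inverse iteration with Wilkinson's shift, in eigen-coordinates *)

Section SpectralMeasure.
Variables (R : realFieldType) (I : finType) (lam : I -> R).
Implicit Types (x : I -> R) (f h : I -> R).

Definition unit_norm x := \sum_i x i ^+ 2 = 1.
(* For [x] the last column of the diagonalizer of [T]: [mean x] is [T_{N,N}],
   [variance x] is [T_{N,N-1}^2], [pen x] is [T_{N-1,N-1}] (and [0] when
   [T_{N,N-1}] vanishes), [charp2 x] is the characteristic polynomial of the
   bottom block and [residual2 x] is [(T_{N,N-1} T_{N-1,N-2})^2]. *)
Definition mean x := \sum_i lam i * x i ^+ 2.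
Definition variance x := \sum_i (lam i - mean x) ^+ 2 * x i ^+ 2.
Definition pen x :=
  (\sum_i lam i * ((lam i - mean x) ^+ 2 * x i ^+ 2)) / variance x.
Definition charp2 x t := (t - pen x) * (t - mean x) - variance x.
Definition residual2 x := \sum_i charp2 x (lam i) ^+ 2 * x i ^+ 2.

(** The first clause makes [w] a root of [charp2 x]. The distances of the two roots from [mean x]
    multiply to [variance x], so the second clause selects a root nearest to [mean x]. *)
Definition is_shift x w :=
  (pen x - w) * (mean x - w) = variance x /\ (mean x - w) ^+ 2 <= variance x.

(** Division-free inverse iteration; for a QR step, [tau] is the last diagonal entry of the
    triangular factor. *)
Definition inverse_step x x' w tau :=
  [/\ is_shift x w, unit_norm x' & forall i, (lam i - w) * x' i = tau * x i].

(** At zero variance [pen] is a mere default value, so a deflated vector is only asked to stay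
    deflated. *)
Definition wilkinson_orbit (xs : nat -> I -> R) :=
  (forall k, unit_norm (xs k)) /\
  forall k, (variance (xs k) = 0 -> variance (xs k.+1) = 0) /\
    (variance (xs k) != 0 ->
     exists w tau, inverse_step (xs k) (xs k.+1) w tau).

Lemma variance_ge0 x : 0 <= variance x.
Proof. by apply: sumr_ge0 => i _; rewrite mulr_ge0 ?sqr_ge0. Qed.

Lemma residual2_ge0 x : 0 <= residual2 x.
Proof. by apply: sumr_ge0 => i _; rewrite mulr_ge0 ?sqr_ge0. Qed.

Lemma sum_sub_mean x : unit_norm x -> \sum_i (lam i - mean x) * x i ^+ 2 = 0.
Proof.
move=> x1; under eq_bigr => i _ do rewrite mulrBl.
by rewrite sumrB -mulr_sumr x1 mulr1 subrr.
Qed.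

Lemma second_moment x t : unit_norm x ->
  \sum_i (lam i - t) ^+ 2 * x i ^+ 2 = variance x + (mean x - t) ^+ 2.
Proof.
move=> x1; rewrite /variance.
transitivity (\sum_i ((lam i - mean x) ^+ 2 * x i ^+ 2 +
   ((mean x - t) *+ 2 * ((lam i - mean x) * x i ^+ 2) +
    (mean x - t) ^+ 2 * x i ^+ 2))).
  by apply: eq_bigr => i _; ring.
by rewrite 2!big_split /= -!mulr_sumr sum_sub_mean // x1 mulr0 add0r mulr1.
Qed.

Lemma variance_le x t : unit_norm x ->
  variance x <= \sum_i (lam i - t) ^+ 2 * x i ^+ 2.
Proof. by move=> x1; rewrite second_moment // lerDl sqr_ge0. Qed.

Lemma penM x : variance x != 0 ->
  \sum_i lam i * ((lam i - mean x) ^+ 2 * x i ^+ 2) = pen x * variance x.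
Proof. by move=> v0; rewrite /pen divfK. Qed.

(** The polynomials [1], [t - mean x] and [charp2 x] are the first monic orthogonal polynomials for
    the weights [x i ^+ 2] at the nodes [lam i]; the formula for [charp2] is their three-term
    recurrence. *)
Lemma charp2_orth x s t : unit_norm x -> variance x != 0 ->
  \sum_i charp2 x (lam i) * (s * lam i + t) * x i ^+ 2 = 0.
Proof.
move=> x1 v0; set c := mean x; set a := pen x; set v := variance x.
transitivity (\sum_i (s * (lam i * ((lam i - c) ^+ 2 * x i ^+ 2)) +
   ((t + s * c - s * a) * ((lam i - c) ^+ 2 * x i ^+ 2) +
   (((c - a) * (t + s * c) - s * v) * ((lam i - c) * x i ^+ 2)
    - (v * (t + s * c)) * x i ^+ 2)))).
  by apply: eq_bigr => i _; rewrite /charp2 -/a -/c -/v; ring.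
rewrite big_split /= big_split /= big_split /= sumrN -!mulr_sumr.
rewrite penM // sum_sub_mean // x1 -/a.
rewrite -/(variance x) -/v; ring.
Qed.

Lemma residual2_add x s t : unit_norm x -> variance x != 0 ->
  \sum_i (charp2 x (lam i) + (s * lam i + t)) ^+ 2 * x i ^+ 2 =
  residual2 x + \sum_i (s * lam i + t) ^+ 2 * x i ^+ 2.
Proof.
move=> x1 v0; rewrite /residual2.
transitivity (\sum_i (charp2 x (lam i) ^+ 2 * x i ^+ 2 +
  (2%:R * (charp2 x (lam i) * (s * lam i + t) * x i ^+ 2) +
   (s * lam i + t) ^+ 2 * x i ^+ 2))).
  by apply: eq_bigr => i _; ring.
by rewrite 2!big_split /= -mulr_sumr charp2_orth // mulr0 add0r.
Qed.

(* [charp2 x] minimizes the norm of [q(Lambda) x] among monic quadratics [q]. *)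
Lemma residual2_le x r t : unit_norm x -> variance x != 0 ->
  residual2 x <= \sum_i ((lam i - r) * (lam i - t)) ^+ 2 * x i ^+ 2.
Proof.
move=> x1 v0; set s := pen x + mean x - r - t.
set d := r * t - pen x * mean x + variance x.
have -> : \sum_i ((lam i - r) * (lam i - t)) ^+ 2 * x i ^+ 2 =
  \sum_i (charp2 x (lam i) + (s * lam i + d)) ^+ 2 * x i ^+ 2.
  by apply: eq_bigr => i _; congr (_ ^+ 2 * _); rewrite /charp2 /s /d; ring.
rewrite residual2_add // lerDl; apply: sumr_ge0 => i _.
by rewrite mulr_ge0 ?sqr_ge0.
Qed.

Lemma cauchy_schwarz_unit f x : unit_norm x ->
  (\sum_i f i * x i) ^+ 2 <= \sum_i f i ^+ 2.
Proof.
move=> x1; set t := \sum_i f i * x i.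
suff: 0 <= \sum_i f i ^+ 2 - t ^+ 2 by rewrite subr_ge0.
have -> : \sum_i f i ^+ 2 - t ^+ 2 = \sum_i (f i - t * x i) ^+ 2.
  transitivity (\sum_i (f i ^+ 2 + ((- 2%:R * t) * (f i * x i) +
     t ^+ 2 * x i ^+ 2))); last by apply: eq_bigr => i _; ring.
  by rewrite 2!big_split /= -!mulr_sumr -/t x1; ring.
by apply: sumr_ge0 => i _; exact: sqr_ge0.
Qed.

Section Step.
Variables (x x' : I -> R) (w tau : R).
Hypotheses (x1 : unit_norm x) (v0 : variance x != 0).
Hypothesis st : inverse_step x x' w tau.

Let v_gt0 : 0 < variance x. Proof. by rewrite lt0r v0 variance_ge0. Qed.

(** The variance is the least second moment, and the second moment of [x'] about [w] is exactly
    [tau ^+ 2]. *)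
Lemma step_variance : variance x' <= tau ^+ 2.
Proof.
case: st => _ x'1 stE; apply: le_trans (variance_le w x'1) _.
rewrite -[leRHS]mulr1 -x1 mulr_sumr; apply: ler_sum => i _.
by rewrite -!exprMn stE.
Qed.

(** Test minimality with the quadratic [(t - w) * (t - mean x)]: its first factor turns [x'] into
    [tau] times [x], its second produces [variance x]. *)
Lemma step_residual2 : variance x' != 0 ->
  residual2 x' <= tau ^+ 2 * variance x.
Proof.
case: st => _ x'1 stE v'0; apply: le_trans (residual2_le w (mean x) x'1 v'0) _.
rewrite mulr_sumr; apply: ler_sum => i _; rewrite -!exprMn.
rewrite mulrAC stE; have -> // : tau * x i * (lam i - mean x) =
  tau * ((lam i - mean x) * x i) by ring.
Qed.

(* Pair [x'] with [(Lambda - w) f(Lambda) x] for the affine [f] with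
   [<f(Lambda) x, x> = 1] interpolating between the constant [1] and the
   multiple of [t - w'], [w'] being the other root of [charp2 x]. *)
Lemma step_tau_le s : tau ^+ 2 <=
  s ^+ 2 * (residual2 x / variance x) + (1 - s) ^+ 2 * (variance x *+ 2).
Proof.
case: st => -[rt cw] x'1 stE.
have aw0 : pen x - w != 0.
  by apply: contraNneq v0 => e; rewrite -rt e mul0r.
set r := (w - pen x)^-1; set z := s * r.
pose f i := z * charp2 x (lam i) + (1 - s) * (lam i - w).
have wa0 : w - pen x != 0 by rewrite -opprB oppr_eq0.
have charE i : charp2 x (lam i) = (lam i - w) * (lam i - (pen x + mean x - w)).
  by rewrite /charp2 -rt; ring.
have tauE : tau = \sum_i f i * x i * x' i.
  transitivity (\sum_i ((tau * z) * ((lam i - mean x) * x i ^+ 2) +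
       tau * x i ^+ 2)).
    by rewrite big_split /= -!mulr_sumr sum_sub_mean // x1; ring.
  apply: eq_bigr => i _; rewrite /f charE.
  transitivity ((z * (lam i - (pen x + mean x - w)) + (1 - s)) * x i *
     ((lam i - w) * x' i)); last by ring.
  by rewrite stE /z /r; field.
rewrite {1}tauE; apply: le_trans (cauchy_schwarz_unit _ x'1) _.
have -> : \sum_i (f i * x i) ^+ 2 =
   z ^+ 2 * residual2 x + (1 - s) ^+ 2 * (variance x + (mean x - w) ^+ 2).
  rewrite -second_moment // /residual2.
  transitivity (\sum_i (z ^+ 2 * (charp2 x (lam i) ^+ 2 * x i ^+ 2) +
    ((2%:R * z) * (charp2 x (lam i) * ((1 - s) * lam i + - ((1 - s) * w)) *
       x i ^+ 2) + (1 - s) ^+ 2 * ((lam i - w) ^+ 2 * x i ^+ 2)))).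
    by apply: eq_bigr => i _; rewrite /f; ring.
  by rewrite 2!big_split /= -!mulr_sumr charp2_orth // mulr0 add0r.
apply: lerD.
  (* Since [w] is the root nearest to [mean x], the product formula forces
     [(pen x - w) ^+ 2 >= variance x], which bounds [r ^+ 2]. *)
  rewrite /z exprMn -mulrA ler_wpM2l ?sqr_ge0 // mulrC.
  rewrite ler_wpM2l ?residual2_ge0 // /r exprVn lef_pV2 ?posrE //; last first.
    by rewrite exprn_even_gt0.
  have cw2 : (pen x - w) ^+ 2 * (mean x - w) ^+ 2 = variance x ^+ 2.
    by rewrite -exprMn rt.
  rewrite -[(w - _) ^+ 2]sqrrN opprB.
  rewrite -(ler_pM2r v_gt0) -expr2 -cw2 ler_wpM2l ?sqr_ge0 //.
by rewrite ler_wpM2l ?sqr_ge0 // mulr2n lerD2l.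
Qed.

Lemma step_tau2 : tau ^+ 2 <= residual2 x / variance x.
Proof. by have := step_tau_le 1; rewrite subrr expr1n mul1r expr0n mul0r addr0. Qed.

(** Optimizing [s] in [step_tau_le] gives half the harmonic mean of [P] and [Q], which is at most
    half their geometric mean. The factor 1/2 gained here is what makes the potential decrease. *)
Lemma step_tau4 : (tau ^+ 2) ^+ 2 <= residual2 x / 2%:R.
Proof.
set P := residual2 x / variance x; set Q := variance x *+ 2.
have Q0 : 0 < Q by rewrite pmulrn_lgt0.
have P0 : 0 <= P by rewrite divr_ge0 ?residual2_ge0 // ltW.
have PQ0 : 0 < P + Q by rewrite ltr_wpDl.
have -> : residual2 x / 2%:R = P * Q / 4%:R.
  by rewrite /P /Q; field.
have PQn0 : P + Q != 0 by rewrite gt_eqF.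
have h : tau ^+ 2 <= P * Q / (P + Q).
  (* The minimizer of [s ^+ 2 * P + (1 - s) ^+ 2 * Q]. *)
  have := step_tau_le (Q / (P + Q)); rewrite -/P -/Q.
  suff -> : (Q / (P + Q)) ^+ 2 * P + (1 - Q / (P + Q)) ^+ 2 * Q
            = P * Q / (P + Q) by [].
  by move: P Q PQn0 {Q0 P0 PQ0} => P Q PQn0; field.
apply: (@le_trans _ _ ((P * Q / (P + Q)) ^+ 2)).
  by rewrite ler_sqr ?nnegrE ?sqr_ge0 // (le_trans _ h) ?sqr_ge0.
rewrite -subr_ge0; have -> : P * Q / 4%:R - (P * Q / (P + Q)) ^+ 2 =
    P * Q * (P - Q) ^+ 2 / (4%:R * (P + Q) ^+ 2).
  by move: P Q PQn0 {Q0 P0 PQ0 h} => P Q PQn0; field.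
apply: divr_ge0; apply: mulr_ge0; rewrite ?sqr_ge0 ?ler0n //.
exact: mulr_ge0 P0 (ltW Q0).
Qed.

(** Each factor on the left contributes one [tau ^+ 2]; their product is controlled by
    [step_tau4]. *)
Lemma step_potential :
  variance x' * residual2 x' <= variance x * residual2 x / 2%:R.
Proof.
have [->|v'0] := eqVneq (variance x') 0.
  by rewrite mul0r divr_ge0 ?mulr_ge0 ?residual2_ge0 // ltW.
apply: (@le_trans _ _ (tau ^+ 2 * (tau ^+ 2 * variance x))).
  by rewrite ler_pM ?variance_ge0 ?residual2_ge0 ?step_variance ?step_residual2.
by rewrite mulrA -expr2 mulrC -mulrA ler_wpM2l ?step_tau4 // ltW.
Qed.

End Step.
End SpectralMeasure.

(** * Quantitative estimates for one step near an eigenvector *)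

Section NearEigenvector.
Variables (R : realFieldType) (I : finType) (lam : I -> R) (g M eps : R).
Hypotheses (g_gt0 : 0 < g) (g_le1 : g <= 1) (M_ge1 : 1 <= M).
Hypothesis spread : forall i j, `|lam i - lam j| <= M.
Hypothesis gap : forall i j, i != j -> g <= `|lam i - lam j|.
Hypothesis ap_gap : forall i j l, j != i -> l != i -> j != l ->
  g <= `| `|lam j - lam i| - `|lam l - lam i| |.
Hypothesis eps_g2 : 256%:R * M ^+ 2 * eps <= g ^+ 2.
Hypothesis eps_g3 : 32%:R * M ^+ 3 * eps <= g ^+ 3.

Local Notation variance := (variance lam).
Local Notation mean := (mean lam).
Local Notation pen := (pen lam).
Local Notation unit_norm := (@unit_norm R I).
Local Notation inverse_step := (inverse_step lam).
Implicit Types (x : I -> R) (i j l : I).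

(** For a unit vector, the squared sine of its angle with the [i]-th axis. *)
Definition off_mass i x := \sum_(j | j != i) x j ^+ 2.

Lemma normr_le_sqr (a b : R) : 0 <= b -> (`|a| <= b) = (a ^+ 2 <= b ^+ 2).
Proof.
by move=> b0; rewrite -(ler_sqr (x := `|a|)) ?nnegrE // real_normK ?num_real.
Qed.

Lemma off_mass_ge0 i x : 0 <= off_mass i x.
Proof. by apply: sumr_ge0 => j _; exact: sqr_ge0. Qed.

Lemma off_massE i x : unit_norm x -> x i ^+ 2 = 1 - off_mass i x.
Proof. by move=> <-; rewrite (bigD1 i) //= addrK. Qed.

Lemma off_mass_le1 i x : unit_norm x -> off_mass i x <= 1.
Proof. by move=> x1; rewrite -subr_ge0 -off_massE ?sqr_ge0. Qed.

Lemma mean_dist i x : unit_norm x -> `|lam i - mean x| <= M * off_mass i x.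
Proof.
move=> x1; have -> : lam i - mean x = \sum_(j | j != i) (lam i - lam j) * x j ^+ 2.
  transitivity (\sum_j (lam i - lam j) * x j ^+ 2).
    under eq_bigr => j _ do rewrite mulrBl.
    by rewrite sumrB -mulr_sumr x1 mulr1.
  by rewrite (bigD1 i) //= subrr mul0r add0r.
apply: le_trans (ler_norm_sum _ _ _) _; rewrite mulr_sumr; apply: ler_sum => j _.
by rewrite normrM (ger0_norm (sqr_ge0 _)) ler_wpM2r ?sqr_ge0.
Qed.

Lemma mean_spread i x : unit_norm x -> `|lam i - mean x| <= M.
Proof.
move=> x1; apply: le_trans (mean_dist i x1) _.
by rewrite ler_piMr ?off_mass_le1 // (le_trans ler01).
Qed.

Lemma sqr_mean_spread i x : unit_norm x -> (lam i - mean x) ^+ 2 <= M ^+ 2.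
Proof.
by move=> x1; rewrite -normr_le_sqr ?mean_spread // (le_trans ler01).
Qed.

Lemma variance_spread x : unit_norm x -> variance x <= M ^+ 2.
Proof.
move=> x1; rewrite -[leRHS]mulr1 -x1 mulr_sumr; apply: ler_sum => i _.
by rewrite ler_wpM2r ?sqr_ge0 // sqr_mean_spread.
Qed.

Lemma residual2_spread x : unit_norm x -> variance x != 0 ->
  residual2 lam x <= M ^+ 4.
Proof.
move=> x1 v0; apply: le_trans (residual2_le (mean x) (mean x) x1 v0) _.
rewrite -[leRHS]mulr1 -x1 mulr_sumr; apply: ler_sum => i _.
rewrite ler_wpM2r ?sqr_ge0 // -expr2 -exprM (exprM _ 2 2) (exprM _ 2 2).
by rewrite ler_sqr ?nnegrE ?sqr_ge0 ?sqr_mean_spread.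
Qed.

Lemma variance_le_off_mass i x : unit_norm x ->
  variance x <= M ^+ 2 * off_mass i x.
Proof.
move=> x1; apply: le_trans (variance_le lam (lam i) x1) _.
rewrite (bigD1 i) //= subrr expr0n mul0r add0r mulr_sumr.
apply: ler_sum => j _; rewrite ler_wpM2r ?sqr_ge0 // -normr_le_sqr ?spread //.
exact: le_trans M_ge1.
Qed.

Lemma off_mass_le_variance i x :
  (forall j, j != i -> g / 2%:R <= `|lam j - mean x|) ->
  g ^+ 2 * off_mass i x <= 4%:R * variance x.
Proof.
move=> far; rewrite /variance (bigD1 i) //= mulrDr; apply: ler_wpDl.
  by rewrite mulr_ge0 // mulr_ge0 ?sqr_ge0.
rewrite !mulr_sumr; apply: ler_sum => j ji; rewrite mulrA.
rewrite ler_wpM2r ?sqr_ge0 //; have := far j ji => h.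
have h2 : (g / 2%:R) ^+ 2 <= (lam j - mean x) ^+ 2.
  rewrite -[leRHS]real_normK ?num_real // ler_sqr ?nnegrE //.
  by rewrite divr_ge0 // ltW.
lra.
Qed.

(** Take [lam i] nearest to the mean: by the gap, every other eigenvalue is at least [g / 2] away
    from the mean, so its mass is paid for by the variance. *)
Lemma small_variance_off_mass (i0 : I) x : 4%:R * variance x <= g ^+ 2 * eps ->
  exists i, off_mass i x <= eps.
Proof.
move=> v_small; pose i := [arg min_(i < i0) `|lam i - mean x|]%O; exists i.
have imin j : `|lam i - mean x| <= `|lam j - mean x|.
  by rewrite /i; case: arg_minP => // k _; apply.
rewrite -(ler_pM2l (exprn_gt0 2 g_gt0)); apply: le_trans v_small.
apply: off_mass_le_variance => j ji.
have := gap ji; have := imin j.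
have := ler_normB (lam j - mean x) (lam i - mean x).
have -> : lam j - mean x - (lam i - mean x) = lam j - lam i by ring.
lra.
Qed.

Local Notation kappa := (g ^+ 3 / (32%:R * M ^+ 3 * #|I|%:R)).

Section Near.
Variables (i : I) (x : I -> R).
Hypotheses (x1 : unit_norm x) (near_x : off_mass i x <= eps).
Let y := off_mass i x.
Let y_ge0 : 0 <= y. Proof. exact: off_mass_ge0. Qed.
Let M_gt0 : 0 < M. Proof. exact: lt_le_trans M_ge1. Qed.
Let g2_gt0 : 0 < g ^+ 2. Proof. exact: exprn_gt0. Qed.
Let g2_le_g : g ^+ 2 <= g. Proof. by rewrite expr2 ler_piMr // ltW. Qed.
Let M_le_M2 : M <= M ^+ 2.
Proof. by rewrite expr2 ler_peMr // ltW. Qed.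
Let M2y : 256%:R * (M ^+ 2 * y) <= g ^+ 2.
Proof.
rewrite mulrA; apply: le_trans eps_g2.
by rewrite ler_wpM2l ?(mulr_ge0 (ler0n _ _) (sqr_ge0 _)).
Qed.
Let My : M * y <= M ^+ 2 * y. Proof. by rewrite ler_wpM2r. Qed.
Let y_le : y <= M ^+ 2 * y.
Proof. by rewrite ler_peMl // (le_trans M_ge1). Qed.

Lemma near_mean : `|lam i - mean x| <= g / 8%:R.
Proof. have := mean_dist i x1; rewrite -/y; move: My M2y g2_le_g g_gt0; lra. Qed.

Lemma near_far j : j != i -> g / 2%:R <= `|lam j - mean x|.
Proof.
move=> ji; have := gap ji; have := near_mean.
have := ler_normB (lam j - mean x) (lam i - mean x).
have -> : lam j - mean x - (lam i - mean x) = lam j - lam i by ring.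
by move: g_gt0; lra.
Qed.

Lemma near_off_mass_le : g ^+ 2 * y <= 4%:R * variance x.
Proof. exact/off_mass_le_variance/near_far. Qed.

Let xi_ge : 1 / 2%:R <= x i ^+ 2.
Proof. by rewrite off_massE // -/y; move: M2y y_le g2_le_g g_le1; lra. Qed.

Section Step.
Variables (x' : I -> R) (w tau : R).
Hypotheses (v0 : variance x != 0) (st : inverse_step x x' w tau).
Let y' := off_mass i x'.

Let x'1 : unit_norm x'. Proof. by case: st. Qed.
Let stE j : (lam j - w) * x' j = tau * x j. Proof. by case: st. Qed.
Let v_gt0 : 0 < variance x. Proof. by rewrite lt0r v0 variance_ge0. Qed.

Lemma shift_dist2 :
  (lam i - w) ^+ 2 <= 2%:R * (M * y) ^+ 2 + 2%:R * (mean x - w) ^+ 2.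
Proof.
have h : (lam i - mean x) ^+ 2 <= (M * y) ^+ 2.
  by rewrite -normr_le_sqr ?mean_dist ?mulr_ge0 // ltW.
have := sqr_ge0 ((lam i - mean x) - (mean x - w)); lra.
Qed.

(** Crude estimate valid for every shift, from [(mean x - w) ^+ 2 <= variance x] and
    [variance x <= M ^+ 2 * y]; it yields quadratic convergence. *)
Lemma shift_dist2_lin : (lam i - w) ^+ 2 <= 4%:R * (M ^+ 2 * y).
Proof.
have := shift_dist2; have := variance_le_off_mass i x1.
have [[_ cw] _ _] := st.
have : (M * y) ^+ 2 <= M ^+ 2 * y.
  rewrite exprMn ler_wpM2l ?sqr_ge0 // expr2 ler_piMr //; exact: off_mass_le1.
by rewrite -/y; lra.
Qed.

Lemma shift_near : `|lam i - w| <= g / 8%:R.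
Proof.
rewrite normr_le_sqr; last by rewrite divr_ge0 // ltW.
by have := shift_dist2_lin; rewrite expr_div_n; move: M2y; lra.
Qed.

Lemma shift_far j : j != i -> g / 2%:R <= `|lam j - w|.
Proof.
move=> ji; have := gap ji; have := shift_near.
have := ler_normB (lam j - w) (lam i - w).
have -> : lam j - w - (lam i - w) = lam j - lam i by ring.
by move: g_gt0; lra.
Qed.

Lemma step_tau_near : tau ^+ 2 <= 2%:R * (lam i - w) ^+ 2.
Proof.
have e : tau ^+ 2 * x i ^+ 2 = (lam i - w) ^+ 2 * x' i ^+ 2.
  by rewrite -!exprMn stE.
have h : (lam i - w) ^+ 2 * x' i ^+ 2 <= (lam i - w) ^+ 2.
  by rewrite ler_piMr ?sqr_ge0 // off_massE // gerBl off_mass_ge0.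
have := ler_wpM2l (sqr_ge0 tau) xi_ge; lra.
Qed.

(** Mode [i] bounds [tau] by a multiple of [lam i - w], while every other mode is multiplied by
    [tau / (lam j - w)], whose denominator is at least [g / 2] in modulus. *)
Lemma step_off_mass : g ^+ 2 * y' <= 8%:R * ((lam i - w) ^+ 2 * y).
Proof.
have h : g ^+ 2 / 4%:R * y' <= tau ^+ 2 * y.
  rewrite /y' /y /off_mass !mulr_sumr; apply: ler_sum => j ji.
  rewrite -[leRHS]exprMn -stE exprMn ler_wpM2r ?sqr_ge0 //.
  have -> : g ^+ 2 / 4%:R = (g / 2%:R) ^+ 2 by field.
  rewrite -[leRHS]real_normK ?num_real // ler_sqr ?nnegrE // ?shift_far //.
  by rewrite divr_ge0 // ltW.
have := ler_wpM2r y_ge0 step_tau_near; lra.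
Qed.

(** Trapping: the estimates in fact give [y' <= y / 8]. *)
Lemma step_near : off_mass i x' <= eps.
Proof.
apply: le_trans near_x; rewrite -/y -/y' -(ler_pM2l g2_gt0).
apply: le_trans step_off_mass _.
have := ler_wpM2r y_ge0 shift_dist2_lin; have := ler_wpM2r y_ge0 M2y.
have := mulr_ge0 (ltW g2_gt0) y_ge0; lra.
Qed.

Lemma step_variance_near :
  g ^+ 2 * variance x' <= 8%:R * M ^+ 2 * ((lam i - w) ^+ 2 * y).
Proof.
have h := variance_le_off_mass i x'1.
have := ler_wpM2l (ltW g2_gt0) h.
have := ler_wpM2l (sqr_ge0 M) step_off_mass; rewrite -/y'; lra.
Qed.

Let g2y_sqr : (g ^+ 2 * y) ^+ 2 <= 16%:R * variance x ^+ 2.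
Proof.
have -> : 16%:R * variance x ^+ 2 = (4%:R * variance x) ^+ 2 by ring.
rewrite ler_sqr ?near_off_mass_le // nnegrE.
  exact: mulr_ge0 (ltW g2_gt0) y_ge0.
exact: mulr_ge0 (ler0n _ _) (ltW v_gt0).
Qed.

(** Here [variance x'] is of order [(lam i - w) ^+ 2 * y], the first factor is of order [y], and [y]
    is of order [variance x]. *)
Lemma step_quadratic : g ^+ 6 * variance x' <= 512%:R * M ^+ 4 * variance x ^+ 2.
Proof.
have h1 := ler_wpM2l (exprn_ge0 4 (ltW g_gt0)) step_variance_near.
have h2 : g ^+ 4 * (8%:R * M ^+ 2 * ((lam i - w) ^+ 2 * y)) <=
          g ^+ 4 * (8%:R * M ^+ 2 * (4%:R * (M ^+ 2 * y) * y)).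
  rewrite ler_wpM2l ?exprn_ge0 ?(ltW g_gt0) // ler_wpM2l //.
    exact: mulr_ge0 (ler0n _ _) (sqr_ge0 _).
  by rewrite ler_wpM2r // shift_dist2_lin.
have h3 := ler_wpM2l (exprn_ge0 4 (ltW M_gt0)) g2y_sqr.
have -> : g ^+ 6 * variance x' = g ^+ 4 * (g ^+ 2 * variance x') by ring.
apply: le_trans h1 (le_trans h2 _).
have -> : g ^+ 4 * (8%:R * M ^+ 2 * (4%:R * (M ^+ 2 * y) * y)) =
  32%:R * (M ^+ 4 * (g ^+ 2 * y) ^+ 2) by ring.
lra.
Qed.

Lemma step_cubic : g <= 4%:R * `|pen x - mean x| ->
  g ^+ 8 * variance x' <= 2048%:R * M ^+ 4 * variance x ^+ 3.
Proof.
move=> far; set v := variance x.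
have [[rt cw] _ _] := st.
have cw1 : g ^+ 2 * (mean x - w) ^+ 2 <= 16%:R * v ^+ 2.
  (* The right-hand side lies between [0] and [v]; with [pen x] away from [mean x] this improves
     [mean x - w] from order [sqrt v] to order [v]. *)
  have e : (mean x - w) * (pen x - mean x) = v - (mean x - w) ^+ 2.
    by rewrite -[v]rt; ring.
  have e2 : ((mean x - w) * (pen x - mean x)) ^+ 2 <= v ^+ 2.
    rewrite e ler_sqr ?nnegrE ?subr_ge0 ?(ltW v_gt0) //.
    by rewrite gerBl sqr_ge0.
  have g2 : g ^+ 2 <= 16%:R * (pen x - mean x) ^+ 2.
    have -> : 16%:R * (pen x - mean x) ^+ 2 = (4%:R * `|pen x - mean x|) ^+ 2.
      by rewrite exprMn real_normK ?num_real //; ring.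
    by rewrite ler_sqr ?nnegrE ?mulr_ge0 // ltW.
  have := ler_wpM2r (sqr_ge0 (mean x - w)) g2; move: e2; rewrite exprMn; lra.
have w2 : g ^+ 4 * (lam i - w) ^+ 2 <= 64%:R * (M ^+ 2 * v ^+ 2).
  have h1 := ler_wpM2l (exprn_ge0 4 (ltW g_gt0)) shift_dist2.
  have h2 := ler_wpM2l (sqr_ge0 M) g2y_sqr.
  have h3 := ler_wpM2l (sqr_ge0 g) cw1.
  have h4 : g ^+ 2 * v ^+ 2 <= M ^+ 2 * v ^+ 2.
    rewrite ler_wpM2r ?sqr_ge0 // ler_sqr ?nnegrE ?(ltW g_gt0) ?(ltW M_gt0) //.
    exact: le_trans M_ge1.
  apply: le_trans h1 _.
  have -> : g ^+ 4 * (2%:R * (M * y) ^+ 2 + 2%:R * (mean x - w) ^+ 2) =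
    2%:R * (M ^+ 2 * (g ^+ 2 * y) ^+ 2) +
    2%:R * (g ^+ 2 * (g ^+ 2 * (mean x - w) ^+ 2)) by ring.
  by move: h2 h3 h4; rewrite -/v; lra.
have h1 := ler_wpM2l (exprn_ge0 6 (ltW g_gt0)) step_variance_near.
have -> : g ^+ 8 * variance x' = g ^+ 6 * (g ^+ 2 * variance x') by ring.
apply: le_trans h1 _.
have -> : g ^+ 6 * (8%:R * M ^+ 2 * ((lam i - w) ^+ 2 * y)) =
  8%:R * M ^+ 2 * ((g ^+ 4 * (lam i - w) ^+ 2) * (g ^+ 2 * y)) by ring.
have -> : 2048%:R * M ^+ 4 * v ^+ 3 =
  8%:R * M ^+ 2 * ((64%:R * (M ^+ 2 * v ^+ 2)) * (4%:R * v)) by ring.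
rewrite ler_wpM2l ?(mulr_ge0 (ler0n _ _) (sqr_ge0 _)) //.
apply: ler_pM near_off_mass_le => //.
  exact: mulr_ge0 (exprn_ge0 _ (ltW g_gt0)) (sqr_ge0 _).
exact: mulr_ge0 (sqr_ge0 _) _.
Qed.

(** A step multiplies [x l ^+ 2 / x j ^+ 2] by [(B / A) ^+ 2]. The distances of [lam j] and [lam l]
    from [lam i] differ by at least [g], and [w] is too close to [lam i] to close that gap. *)
Lemma step_ratio j l r : j != i -> l != i -> j != l ->
  `|lam l - lam i| <= `|lam j - lam i| ->
  0 <= r -> r * x j ^+ 2 <= x l ^+ 2 ->
  r * (1 + g / (4%:R * M)) * x' j ^+ 2 <= x' l ^+ 2.
Proof.
move=> ji li jl lelj r0 rx.
set A := `|lam l - w|; set B := `|lam j - w|; set q := 1 + g / (4%:R * M).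
have A0 : 0 < A by apply: lt_le_trans (shift_far li); rewrite divr_gt0.
have sn := shift_near.
have gB : A + g / 2%:R <= B.
  have := ap_gap ji li jl; rewrite ger0_norm ?subr_ge0 // => h.
  have := ler_normB (lam j - w) (lam i - w).
  have := ler_normD (lam l - lam i) (lam i - w).
  have -> : lam j - w - (lam i - w) = lam j - lam i by ring.
  have -> : lam l - lam i + (lam i - w) = lam l - w by ring.
  rewrite -/A -/B; lra.
have A2M : A <= 2%:R * M.
  have := ler_normD (lam l - lam i) (lam i - w).
  have -> : lam l - lam i + (lam i - w) = lam l - w by ring.
  have := spread l i; rewrite -/A; move: sn M_ge1 g_le1; lra.
have q1 : 1 <= q by rewrite lerDl divr_ge0 ?mulr_ge0 ?ltW.
(* The excess [g / (4 * M)] in [q] is the gap [g / 2] divided by the bound [2 * M] on [A]. *)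
have qA : q * A <= B.
  apply: le_trans gB; rewrite mulrDl mul1r lerD2l mulrAC ler_pdivrMr ?mulr_gt0 //.
  by have := ler_wpM2l (ltW g_gt0) A2M; lra.
have qA2 : q * A ^+ 2 <= B ^+ 2.
  have : (q * A) ^+ 2 <= B ^+ 2.
    have qA0 : 0 <= q * A := mulr_ge0 (le_trans ler01 q1) (ltW A0).
    by rewrite ler_sqr // nnegrE ?normr_ge0.
  apply: le_trans; rewrite exprMn ler_wpM2r ?sqr_ge0 // expr2 ler_peMr //.
  exact: le_trans q1.
rewrite -(ler_pM2l (exprn_gt0 2 A0)).
rewrite [leRHS](_ : _ = tau ^+ 2 * x l ^+ 2); last first.
  by rewrite /A real_normK ?num_real // -!exprMn stE.
apply: (@le_trans _ _ (r * (B ^+ 2 * x' j ^+ 2))).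
  have := ler_wpM2l r0 (ler_wpM2r (sqr_ge0 (x' j)) qA2); lra.
rewrite /B real_normK ?num_real // -exprMn stE exprMn mulrCA.
by rewrite ler_wpM2l ?sqr_ge0.
Qed.

End Step.

(** [pen x] is the average of the [lam j] with weights [W j]. Being close to [lam i], where the
    weight is negligible, it must balance at least two other modes. *)
Lemma noncubic_comparable : variance x != 0 -> 4%:R * `|pen x - mean x| < g ->
  exists j l, [/\ j != i, l != i & j != l] /\
    [/\ 0 < x j ^+ 2, kappa * x j ^+ 2 <= x l ^+ 2
      & kappa * x l ^+ 2 <= x j ^+ 2].
Proof.
move=> v0 close; set v := variance x.
have v_gt0 : 0 < v by rewrite lt0r v0 variance_ge0.
pose W j := (lam j - mean x) ^+ 2 * x j ^+ 2.
have W0 j : 0 <= W j by rewrite mulr_ge0 ?sqr_ge0.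
have penB j : `|pen x - lam j| * v <= M * \sum_(l | l != j) W l.
  have -> : `|pen x - lam j| * v = `|\sum_(l | l != j) (lam l - lam j) * W l|.
    rewrite -{1}(ger0_norm (ltW v_gt0)) -normrM; congr `|_|.
    transitivity (\sum_l (lam l - lam j) * W l); last first.
      by rewrite (bigD1 j) //= subrr mul0r add0r.
    rewrite mulrBl /v -penM //.
    under [RHS]eq_bigr => l _ do rewrite mulrBl.
    by rewrite sumrB -mulr_sumr.
  apply: le_trans (ler_norm_sum _ _ _) _; rewrite mulr_sumr; apply: ler_sum => l _.
  by rewrite normrM (ger0_norm (W0 l)) ler_wpM2r.
(* Otherwise [pen x] is within [g / 4] of [lam j], hence [mean x] is too close to both [lam i] and
   [lam j]. *)
have undominated j : j != i -> g * v < 4%:R * M * \sum_(l | l != j) W l.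
  move=> ji; rewrite ltNge; apply/negP => dom.
  have : `|pen x - lam j| * v <= g / 4%:R * v by have := penB j; lra.
  rewrite ler_pM2r // => pl; have := gap ji; have := near_mean.
  have := ler_normD (lam j - pen x) (pen x - mean x).
  have := ler_normB (lam j - mean x) (lam i - mean x).
  have -> : lam j - mean x - (lam i - mean x) = lam j - lam i by ring.
  have -> : lam j - pen x + (pen x - mean x) = lam j - mean x by ring.
  by rewrite (distrC (lam j) (pen x)); move: pl close g_gt0; lra.
(* [W i] is of order [y ^+ 2], whereas [v] is at least of order [y]; this is where [eps_g3]
   enters. *)
have Wi : 8%:R * M * W i <= g * v.
  have h1 : W i <= (M * y) ^+ 2.
    apply: (@le_trans _ _ ((lam i - mean x) ^+ 2)).
      by rewrite ler_piMr ?sqr_ge0 // off_massE // gerBl.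
    by rewrite -normr_le_sqr ?mean_dist ?mulr_ge0 // ltW.
  have h2 := ler_wpM2l (ltW M_gt0) h1.
  have h3 : 32%:R * M ^+ 3 * y <= g ^+ 3.
    apply: le_trans eps_g3; rewrite ler_wpM2l //.
    exact: mulr_ge0 (ler0n _ _) (exprn_ge0 _ (ltW M_gt0)).
  have h4 := ler_wpM2r y_ge0 h3.
  have h5 := ler_wpM2l (ltW g_gt0) near_off_mass_le.
  move: h2 h4 h5; rewrite -/v.
  have -> : M * (M * y) ^+ 2 = M ^+ 3 * y * y by ring.
  have -> : g ^+ 3 * y = g * (g ^+ 2 * y) by ring.
  by lra.
have [j0 j0i] : exists j, j != i.
  case: (pickP (fun j => j != i)) => [j ji|none]; first by exists j.
  have := variance_le_off_mass i x1; rewrite /off_mass big_pred0 // mulr0.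
  by rewrite leNgt v_gt0.
pose j := [arg max_(j > j0 | j != i) W j]%O.
have [ji jmax] : j != i /\ forall l, l != i -> W l <= W j.
  by rewrite /j; case: arg_maxP => // k ki kmax; split.
have rest : g * v < 8%:R * M * \sum_(l | (l != j) && (l != i)) W l.
  have := undominated j ji; rewrite (bigD1 i) //= 1?eq_sym //; lra.
have N_gt0 : (0 : R) < #|I|%:R by rewrite ltr0n; apply/card_gt0P; exists i.
have Wj_le : W j <= v.
  have -> : v = \sum_l W l by [].
  rewrite (bigD1 j) //= lerDl.
  by apply: sumr_ge0 => l _; exact: W0.
(* Pigeonhole: one of the remaining modes carries at least a [1 / #|I|] share of the bound
   [rest]. *)
have [l [lj li Wl]] : exists l, [/\ l != j, l != i &
    g * v < 8%:R * M * #|I|%:R * W l].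
  case: (pickP (fun l => [&& l != j, l != i & g * v < 8%:R * M * #|I|%:R * W l])).
    by move=> l /and3P[]; exists l.
  move=> none; suff : 8%:R * M * \sum_(l | (l != j) && (l != i)) W l <= g * v.
    by rewrite leNgt rest.
  have le_l l : (l != j) && (l != i) -> W l <= g * v / (8%:R * M * #|I|%:R).
    move=> /andP[lj li]; have := none l; rewrite /= lj li /= => /negbT.
    by rewrite -leNgt ler_pdivlMr ?mulr_gt0 // mulrC.
  apply: (@le_trans _ _ (8%:R * M * \sum_(l : I) g * v / (8%:R * M * #|I|%:R))).
    rewrite ler_wpM2l ?mulr_ge0 ?(ltW M_gt0) //.
    apply: le_trans (ler_sum _ le_l) _.
    rewrite [leRHS](bigID (fun l => (l != j) && (l != i))) /=.
    by rewrite lerDl; apply: sumr_ge0 => l _; rewrite divr_ge0 ?mulr_ge0 ?ltW.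
  rewrite sumr_const -[_ *+ #|_|]mulr_natr.
  have M0 := lt0r_neq0 M_gt0; have n0 := lt0r_neq0 N_gt0.
  by rewrite le_eqVlt; apply/orP; left; apply/eqP; field; rewrite M0 n0.
have Wub k : W k <= M ^+ 2 * x k ^+ 2.
  by rewrite ler_wpM2r ?sqr_ge0 // sqr_mean_spread.
have Wlb k : k != i -> g ^+ 2 / 4%:R * x k ^+ 2 <= W k.
  move=> ki; rewrite ler_wpM2r ?sqr_ge0 //.
  have -> : g ^+ 2 / 4%:R = (g / 2%:R) ^+ 2 by field.
  rewrite -[leRHS]real_normK ?num_real // ler_sqr ?nnegrE ?near_far //.
  by rewrite divr_ge0 // ltW.
have M3 : M ^+ 2 <= M ^+ 3 by rewrite [leRHS]exprSr ler_peMr ?sqr_ge0.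
have N_ge1 : (1 : R) <= #|I|%:R by rewrite ler1n; apply/card_gt0P; exists i.
have D_gt0 : 0 < 32%:R * M ^+ 3 * #|I|%:R by rewrite !mulr_gt0 ?exprn_gt0.
have Wl_gt0 : 0 < W l.
  have : 0 < 8%:R * M * #|I|%:R * W l by apply: lt_trans Wl; rewrite mulr_gt0.
  by rewrite pmulr_rgt0 // !mulr_gt0.
exists j, l; split; first by split=> //; rewrite eq_sym.
split.
- have : 0 < M ^+ 2 * x j ^+ 2.
    exact: lt_le_trans (lt_le_trans Wl_gt0 (jmax l li)) (Wub j).
  by rewrite pmulr_rgt0 // exprn_gt0.
(* Origin of [kappa]: chain [g ^+ 2 / 4 * x j ^+ 2 <= W j <= v], [g * v < 8 * M * #|I| * W l] and
   [W l <= M ^+ 2 * x l ^+ 2]. *)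
- rewrite mulrAC ler_pdivrMr //.
  have h1 := ler_wpM2l (ltW g_gt0) (le_trans (Wlb j ji) Wj_le).
  have h2 := ler_wpM2l (mulr_ge0 (mulr_ge0 (ler0n R 8) (ltW M_gt0)) (ler0n R #|I|))
               (Wub l).
  apply: (@le_trans _ _ (4%:R * (g * (g ^+ 2 / 4%:R * x j ^+ 2)))).
    by rewrite le_eqVlt; apply/orP; left; apply/eqP; field.
  apply: (@le_trans _ _ (4%:R * (8%:R * M * #|I|%:R * (M ^+ 2 * x l ^+ 2)))).
    by rewrite ler_wpM2l //; apply: le_trans h1 (le_trans (ltW Wl) h2).
  by rewrite le_eqVlt; apply/orP; left; apply/eqP; ring.
- rewrite mulrAC ler_pdivrMr //.
  have h1 : g ^+ 3 * x l ^+ 2 <= g ^+ 2 * x l ^+ 2.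
    by rewrite ler_wpM2r ?sqr_ge0 // [leLHS]exprSr ler_piMr ?sqr_ge0.
  have h2 := le_trans (Wlb l li) (le_trans (jmax l li) (Wub j)).
  have h3 : M ^+ 2 * x j ^+ 2 <= M ^+ 3 * x j ^+ 2 by rewrite ler_wpM2r ?sqr_ge0.
  have h4 : 4%:R * (M ^+ 3 * x j ^+ 2) <=
      32%:R * (M ^+ 3 * x j ^+ 2) * #|I|%:R.
    have p : 0 <= M ^+ 3 * x j ^+ 2.
      by rewrite mulr_ge0 ?sqr_ge0 ?exprn_ge0 // ltW.
    have := ler_wpM2l p N_ge1; lra.
  by lra.
Qed.

End Near.

(** * Orbits: arrival near an eigenvector, trapping, and the count of noncubic steps *)

Section Orbit.
Variable xs : nat -> I -> R.
Hypothesis orb : wilkinson_orbit lam xs.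
Local Notation v k := (variance (xs k)).
Let xs1 k : unit_norm (xs k). Proof. by case: orb. Qed.
Let M_gt0 : 0 < M. Proof. exact: lt_le_trans M_ge1. Qed.

Lemma orbit_step k : v k != 0 -> exists w tau, inverse_step (xs k) (xs k.+1) w tau.
Proof. by case: orb => _ /(_ k) []. Qed.

Lemma orbit_variance0 k : v k = 0 -> v k.+1 = 0.
Proof. by case: orb => _ /(_ k) []. Qed.

Lemma orbit_potential k : (forall m, (m <= k)%N -> v m != 0) ->
  v k * residual2 lam (xs k) <= M ^+ 6 / 2%:R ^+ k.
Proof.
elim: k => [|k IH] v0.
  rewrite expr0 divr1 (exprD _ 2 4) ler_pM ?residual2_ge0 ?variance_ge0
    ?variance_spread //.
  exact/residual2_spread/v0.
have vk : v k != 0 by apply: v0; exact: leqW.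
have [w [tau st]] := orbit_step vk.
apply: le_trans (step_potential (xs1 k) vk st) _.
rewrite [2%:R ^+ k.+1]exprSr invfM mulrA ler_wpM2r ?invr_ge0 //.
by apply: IH => m mk; apply: v0; exact: leqW.
Qed.

(** If the variance stays above [d], halving brings the potential below [d ^+ 3] at step [K], as
    [K <= 2 ^ K]. Then [residual2] is at most [d * v K], and [step_tau2] gives [v K.+1 <= d]. *)
Lemma orbit_small_variance (d : R) (K : nat) : 0 < d -> M ^+ 6 < K%:R * d ^+ 3 ->
  exists2 k, (k <= K.+1)%N & v k <= d.
Proof.
move=> d0 hK; case: (pickP (fun k : 'I_K.+2 => v k <= d)) => [k vk|none].
  by exists k => //; rewrite -ltnS.
have big m : (m <= K.+1)%N -> d < v m.
  by move=> mK; have := none (inord m); rewrite inordK ?ltnS // ltNge => /= ->.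
have vn0 m : (m <= K.+1)%N -> v m != 0.
  by move=> mK; rewrite gt_eqF // (lt_trans d0) ?big.
have d3 := exprn_gt0 3 d0; have vK := big K (leqnSn K).
have vK0 := lt_trans d0 vK.
have KK : K%:R <= 2%:R ^+ K :> R.
  by rewrite -natrX ler_nat; apply: ltnW; exact: ltn_expl.
have pot : v K * residual2 lam (xs K) < d ^+ 3.
  apply: le_lt_trans (orbit_potential _) _ => [m mK|].
    by apply: vn0; exact: leqW.
  rewrite ltr_pdivrMr ?exprn_gt0 //; apply: lt_le_trans hK _.
  by have := ler_wpM2r (ltW d3) KK; rewrite [2%:R ^+ K * _]mulrC.
have [w [tau st]] := orbit_step (vn0 K (leqnSn K)).
have h1 := le_trans (step_variance (xs1 K) st)
                    (step_tau2 (xs1 K) (vn0 K (leqnSn K)) st).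
exists K.+1 => //; apply: le_trans h1 _; rewrite ler_pdivrMr //.
have res0 := residual2_ge0 lam (xs K).
have h2 := ler_wpM2r res0 (ltW vK).
have : d * residual2 lam (xs K) <= d * (d * v K).
  apply: le_trans h2 (le_trans (ltW pot) _).
  by rewrite [d ^+ 3]exprS ler_wpM2l ?(ltW d0) // expr2 ler_wpM2l ?(ltW d0) // ltW.
by rewrite ler_pM2l.
Qed.

Section Trapped.
Variables (i : I) (k0 : nat).
Hypothesis near0 : off_mass i (xs k0) <= eps.

(** The alternative is there because [wilkinson_orbit] no longer relates consecutive vectors after
    deflation. *)
Lemma orbit_near k : (k0 <= k)%N -> v k = 0 \/ off_mass i (xs k) <= eps.
Proof.
move=> /subnKC <-; elim: (k - k0)%N => [|m IH]; first by rewrite addn0; right.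
have [vm|vm] := eqVneq (v (k0 + m)) 0.
  by left; rewrite addnS; exact: orbit_variance0.
case: IH => [/eqP|nm]; first by rewrite (negPf vm).
have [w [tau st]] := orbit_step vm.
by right; rewrite addnS; exact: (step_near (xs1 (k0 + m)%N) nm st).
Qed.

Lemma orbit_near_variance k : (k0 <= k)%N -> v k <= M ^+ 2 * eps.
Proof.
have eps_ge0 : 0 <= eps by apply: le_trans near0; exact: off_mass_ge0.
move=> /orbit_near [->|nk]; first by rewrite mulr_ge0 ?exprn_ge0 // ltW.
apply: le_trans (variance_le_off_mass i (xs1 k)) _.
by rewrite ler_wpM2l ?exprn_ge0 // ltW.
Qed.

Lemma orbit_quadratic k : (k0 <= k)%N ->
  g ^+ 6 * v k.+1 <= 512%:R * M ^+ 4 * v k ^+ 2.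
Proof.
move=> kk; have [vk|vk] := eqVneq (v k) 0.
  by rewrite (orbit_variance0 vk) vk mulr0 expr0n mulr0.
case: (orbit_near kk) => [/eqP|nk]; first by rewrite (negPf vk).
have [w [tau st]] := orbit_step vk.
exact (step_quadratic (xs1 k) nk vk st).
Qed.

(** The pair is oriented: [p.1] is the mode farther from [lam i], hence the one that decays
    faster. *)
Definition comparable_modes k (p : I * I) :=
  [&& p.1 != i, p.2 != i, p.1 != p.2, `|lam p.2 - lam i| <= `|lam p.1 - lam i|,
      0 < xs k p.1 ^+ 2,
      kappa * xs k p.1 ^+ 2 <= xs k p.2 ^+ 2
    & kappa * xs k p.2 ^+ 2 <= xs k p.1 ^+ 2].

Let kappa_gt0 : 0 < kappa.
Proof.
rewrite divr_gt0 ?exprn_gt0 // !mulr_gt0 ?exprn_gt0 // ltr0n.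
by apply/card_gt0P; exists i.
Qed.

Lemma orbit_noncubic k : (k0 <= k)%N ->
  2048%:R * M ^+ 4 * v k ^+ 3 < g ^+ 8 * v k.+1 ->
  v k != 0 /\ exists p, comparable_modes k p.
Proof.
move=> kk; have [vk|vk] := eqVneq (v k) 0.
  by rewrite (orbit_variance0 vk) vk mulr0 expr0n mulr0 ltxx.
case: (orbit_near kk) => [/eqP|nk]; first by rewrite (negPf vk).
have [w [tau st]] := orbit_step vk => bad; split=> //.
have close : 4%:R * `|pen (xs k) - mean (xs k)| < g.
  by rewrite ltNge; apply: contraL bad => far; rewrite -leNgt;
     exact (step_cubic (xs1 k) nk vk st far).
have [j [l [[ji li jl] [xj jl1 jl2]]]] := noncubic_comparable (xs1 k) nk vk close.
have xl : 0 < xs k l ^+ 2 by apply: lt_le_trans jl1; rewrite mulr_gt0.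
have [le_lj|/ltW le_jl] := leP `|lam l - lam i| `|lam j - lam i|.
  by exists (j, l); rewrite /comparable_modes /= ji li jl le_lj xj jl1 jl2.
exists (l, j); rewrite /comparable_modes /= ji li eq_sym jl le_jl xl jl1 jl2.
by [].
Qed.

Local Notation q := (1 + g / (4%:R * M)).

Let q_gt0 : 0 < q. Proof. by rewrite ltr_wpDr ?divr_ge0 ?mulr_ge0 // ltW. Qed.

Lemma comparable_modes_grow k m p : (k0 <= k)%N -> comparable_modes k p ->
  v (k + m) != 0 ->
  kappa * q ^+ m * xs (k + m) p.1 ^+ 2 <= xs (k + m) p.2 ^+ 2.
Proof.
move=> kk /and5P[pi1 pi2 p12 le_p /and3P[_ h _]].
elim: m => [|m IH] vm; first by rewrite addn0 expr0 mulr1.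
have vm' : v (k + m) != 0.
  by apply: contraNneq vm => e; rewrite addnS orbit_variance0.
case: (orbit_near (leq_trans kk (leq_addr m k))) => [/eqP|nk].
  by rewrite (negPf vm').
have [w [tau st]] := orbit_step vm'; rewrite addnS.
have r0 : 0 <= kappa * q ^+ m by rewrite mulr_ge0 ?exprn_ge0 ?ltW.
rewrite [q ^+ m.+1]exprSr [kappa * _]mulrA.
exact (step_ratio (xs1 (k + m)%N) nk st pi1 pi2 p12 le_p r0 (IH vm')).
Qed.

Variable L : nat.
Hypothesis growth : 1 < kappa ^+ 2 * q ^+ L.+1.

(** The ratio of the modes starts at [kappa] or more and grows by [q] at each step; by [growth] it
    exceeds [kappa^-1] after [L.+1] steps, and comparability is lost for good. *)
Lemma comparable_modes_near k m p : (k0 <= k)%N -> comparable_modes k p ->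
  v (k + m) != 0 -> comparable_modes (k + m) p -> (m < L.+1)%N.
Proof.
move=> kk ck vm cm; have h := comparable_modes_grow kk ck vm.
case/and5P: cm => _ _ _ _ /and3P[x0 _ h2].
rewrite ltnNge; apply/negP => Lm.
have qL : q ^+ L.+1 <= q ^+ m.
  by rewrite ler_weXn2l // lerDl divr_ge0 ?mulr_ge0 // ltW.
have h3 := ler_wpM2l (ltW kappa_gt0) h.
have : kappa ^+ 2 * q ^+ m * xs (k + m) p.1 ^+ 2 <= xs (k + m) p.1 ^+ 2.
  by apply: le_trans h2; rewrite expr2 -!mulrA; rewrite -!mulrA in h3.
rewrite ger_pMl // leNgt; apply/negP/negPn.
by apply: lt_le_trans growth _; rewrite ler_wpM2l ?sqr_ge0.
Qed.

(** Inject the noncubic steps into a finite type: an early step goes to itself, a late one to its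
    residue modulo [L.+1] and a comparable pair. Late steps sharing a pair are at most [L] apart, so
    equal residues identify them. *)
Lemma orbit_noncubic_count K s : (k0 <= K)%N -> uniq s ->
  {in s, forall k, 2048%:R * M ^+ 4 * v k ^+ 3 < g ^+ 8 * v k.+1} ->
  (size s <= K.+1 + L.+1 * (#|I| * #|I|))%N.
Proof.
move=> kK us hs.
(* The default [(i, i)] is never reached at a noncubic step beyond [k0]. *)
pose mode k := odflt (i, i) [pick p | comparable_modes k p].
pose F k : 'I_K.+1 + 'I_L.+1 * (I * I) :=
  if (k <= K)%N then inl (inord k) else inr (inord (k %% L.+1), mode k).
have Finj : {in s &, injective F}.
  have wlogF k m : k \in s -> (k + m)%N \in s -> F k = F (k + m)%N -> m = 0%N.
    move=> ks kms; rewrite /F; case: leqP => kK'; case: leqP => kmK' //.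
      case=> /(congr1 val); rewrite /= !inordK ?ltnS // => e.
      by apply/eqP; rewrite -(eqn_add2l k) -e addn0.
    case=> /(congr1 val); rewrite /= !inordK ?ltn_mod // => em.
    have k0k : (k0 <= k)%N := leq_trans kK (ltnW kK').
    have [vk ek] := orbit_noncubic k0k (hs _ ks).
    have [vm em'] := orbit_noncubic (leq_trans k0k (leq_addr m k)) (hs _ kms).
    rewrite /mode; case: pickP => [p ck|none]; last by case: ek => p; rewrite none.
    case: pickP => [p' cm|none]; last by case: em' => p'; rewrite none.
    move=> /= pp; rewrite -pp in cm; have mL := comparable_modes_near k0k ck vm cm.
    have := eqn_mod_dvd L.+1 (leq_addr m k); rewrite -em eqxx addKn.
    by case: m mL {kms kmK' em cm vm em' pp} => // m mL; rewrite gtnNdvd.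
  move=> a b sa sb; case/orP: (leq_total a b) => /subnKC e E.
    have := wlogF a (b - a)%N sa; rewrite e => /(_ sb E) z.
    by rewrite -e z addn0.
  have := wlogF b (a - b)%N sb; rewrite e => /(_ sa (esym E)) z.
  by rewrite -e z addn0.
have uF : uniq (map F s) by rewrite map_inj_in_uniq.
rewrite -(size_map F) -(card_uniqP uF); apply: leq_trans (max_card _) _.
by rewrite card_sum !card_prod !card_ord.
Qed.

End Trapped.
End Orbit.
End NearEigenvector.

(** * Constants depending on the spectrum alone *)

Lemma finite_pos_lower_bound (R : realFieldType) (T : finType) (P : pred T)
    (f : T -> R) : (forall t, P t -> 0 < f t) ->
  exists e, [/\ 0 < e, e <= 1 & forall t, P t -> e <= f t].
Proof.
move=> fP; exists (\big[Num.min/1]_(t | P t) f t); split.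
- exact: lt_bigmin.
- exact: bigmin_le_id.
- by move=> t Pt; exact: bigmin_le_cond.
Qed.

Lemma bernoulli (R : realDomainType) (x : R) n : 0 <= x ->
  1 + n%:R * x <= (1 + x) ^+ n.
Proof.
move=> x0; elim: n => [|n IH]; first by rewrite mul0r addr0 expr0.
rewrite exprS; have h := ler_wpM2l (addr_ge0 ler01 x0) IH; apply: le_trans h.
have : 0 <= n%:R * x * x by rewrite !mulr_ge0.
by rewrite -natr1; lra.
Qed.

Lemma unbounded_expr (R : archiRealFieldType) (x y : R) : 0 < x ->
  exists n, y < (1 + x) ^+ n.
Proof.
move=> x0; exists (Num.bound (`|y| / x)).
have := archi_boundP (divr_ge0 (normr_ge0 y) (ltW x0)).
rewrite ltr_pdivrMr // => h; apply: le_lt_trans (ler_norm y) (lt_le_trans h _).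
by apply: le_trans (bernoulli _ (ltW x0)); rewrite lerDr.
Qed.

Lemma orbit_asymptotics (R : archiRealFieldType) (I : finType) (i0 : I)
    (lam : I -> R) :
  (forall i j, i != j -> lam i != lam j) ->
  (forall i j k, i != j -> i != k -> j != k -> lam i *+ 2 != lam j + lam k) ->
  exists (C : R) (K : nat), [/\ 0 < C, (0 < K)%N &
    forall xs, wilkinson_orbit lam xs ->
      (forall k, (K < k)%N -> C ^+ 2 * variance lam (xs k.+1) < 1 /\
         variance lam (xs k.+1) <= C ^+ 2 * variance lam (xs k) ^+ 2) /\
      (forall s, uniq s ->
         {in s, forall k, C ^+ 2 * variance lam (xs k) ^+ 3 <
                          variance lam (xs k.+1)} -> (size s <= K)%N)].
Proof.
move=> inj ap.
have [g1 [g1_gt0 g1_le1 g1P]] :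
  exists e, [/\ 0 < e, e <= 1 & forall p : I * I, p.1 != p.2 ->
    e <= `|lam p.1 - lam p.2|].
  apply: finite_pos_lower_bound => -[i j] /= ij.
  by rewrite normr_gt0 subr_eq0 inj.
have [g2 [g2_gt0 g2_le1 g2P]] : exists e, [/\ 0 < e, e <= 1 &
    forall p : I * I * I,
    [&& p.1.2 != p.1.1, p.2 != p.1.1 & p.1.2 != p.2] ->
    e <= `| `|lam p.1.2 - lam p.1.1| - `|lam p.2 - lam p.1.1| |].
  apply: finite_pos_lower_bound => -[[i j] l] /= /and3P[ji li jl].
  (* Equal moduli mean equal or opposite differences: the first contradicts distinctness, the second
     makes [lam i] the midpoint of [lam j] and [lam l]. *)
  rewrite normr_gt0 subr_eq0 eqr_norm2 negb_or; apply/andP; split.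
    by apply: contraNneq (inj _ _ jl) => /addIr ->.
  rewrite opprB -subr_eq0 opprB addrA -addrAC.
  apply: contraNneq (ap i j l _ _ jl) => [/eqP||]; rewrite 1?eq_sym //.
  by rewrite mulr2n => e; apply/eqP; move/eqP: e; lra.
pose g := Num.min g1 g2.
have g_gt0 : 0 < g by rewrite lt_min g1_gt0.
have g_le1 : g <= 1 by rewrite ge_min g1_le1.
have gap i j : i != j -> g <= `|lam i - lam j|.
  by move=> ij; rewrite ge_min (g1P (i, j)).
have ap_gap i j l : j != i -> l != i -> j != l ->
    g <= `| `|lam j - lam i| - `|lam l - lam i| |.
  by move=> ji li jl; rewrite ge_min (g2P (i, j, l)) ?orbT //= ji li jl.
pose M := 1 + \sum_(p : I * I) `|lam p.1 - lam p.2|.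
have M_ge1 : 1 <= M by rewrite lerDl sumr_ge0.
have spread i j : `|lam i - lam j| <= M.
  rewrite /M (bigD1 (i, j)) //= addrCA lerDl addr_ge0 // sumr_ge0 //.
have M_gt0 : 0 < M by exact: lt_le_trans M_ge1.
clearbody g M; clear g1 g1_gt0 g1_le1 g1P g2 g2_gt0 g2_le1 g2P.
(* The constant of [step_cubic]; it also covers [step_quadratic] because [g <= 1]. As [C >= 1], it
   may be replaced by [C ^+ 2], the form needed for squared subdiagonal entries. *)
pose C := 2048%:R * M ^+ 4 / g ^+ 8.
have g8_gt0 : 0 < g ^+ 8 by rewrite exprn_gt0.
have g8C : g ^+ 8 * C = 2048%:R * M ^+ 4 by rewrite mulrC divfK ?gt_eqF.
have C_ge1 : 1 <= C.
  rewrite ler_pdivlMr // mul1r.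
  have h : g ^+ 8 <= 1 by rewrite exprn_ile1 // ltW.
  have : 1 <= M ^+ 4 by rewrite exprn_ege1.
  lra.
have C_gt0 : 0 < C by exact: lt_le_trans C_ge1.
have C_leC2 : C <= C ^+ 2 by rewrite expr2 ler_peMr // ltW.
clearbody C.
(* Small enough for both local hypotheses and for [C ^+ 2 * variance < 1] once trapped. *)
pose eps := g ^+ 3 / (256%:R * M ^+ 3 * C ^+ 2).
have M0 : M != 0 by rewrite gt_eqF.
have C0 : C != 0 by rewrite gt_eqF.
have g0 : g != 0 by rewrite gt_eqF.
have C2_ge1 : 1 <= C ^+ 2 by exact: le_trans C_leC2.
have g3_gt0 : 0 < g ^+ 3 by rewrite exprn_gt0.
have eps_gt0 : 0 < eps by rewrite divr_gt0 // !mulr_gt0 ?exprn_gt0.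
have eps_g2 : 256%:R * M ^+ 2 * eps <= g ^+ 2.
  have -> : 256%:R * M ^+ 2 * eps = g ^+ 3 / (M * C ^+ 2).
    by rewrite /eps; field; rewrite M0 C0.
  rewrite ler_pdivrMr ?mulr_gt0 ?exprn_gt0 // exprSr ler_pM2l ?exprn_gt0 //.
  apply: le_trans g_le1 _; rewrite -[1]mul1r.
  by apply: ler_pM.
have eps_g3 : 32%:R * M ^+ 3 * eps <= g ^+ 3.
  have -> : 32%:R * M ^+ 3 * eps = g ^+ 3 / (8%:R * C ^+ 2).
    by rewrite /eps; field; rewrite M0 C0.
  rewrite ler_pdivrMr ?mulr_gt0 ?exprn_gt0 // ler_peMr ?ltW //; lra.
have eps_C : C ^+ 2 * (M ^+ 2 * eps) < 1.
  have -> : C ^+ 2 * (M ^+ 2 * eps) = g ^+ 3 / (256%:R * M).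
    by rewrite /eps; field; rewrite M0 C0.
  rewrite ltr_pdivrMr ?mulr_gt0 //.
  have : g ^+ 3 <= 1 by rewrite exprn_ile1 // ltW.
  lra.
clearbody eps.
pose d := g ^+ 2 * eps / 4%:R.
have d_gt0 : 0 < d by rewrite divr_gt0 // mulr_gt0 // exprn_gt0.
pose K1 := Num.bound (M ^+ 6 / d ^+ 3).
have K1P : M ^+ 6 < K1%:R * d ^+ 3.
  rewrite -ltr_pdivrMr ?exprn_gt0 //; apply: archi_boundP.
  by rewrite divr_ge0 ?exprn_ge0 // ltW.
pose kappa := g ^+ 3 / (32%:R * M ^+ 3 * #|I|%:R).
have kappa_gt0 : 0 < kappa.
  rewrite divr_gt0 ?exprn_gt0 // !mulr_gt0 ?exprn_gt0 // ltr0n.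
  by apply/card_gt0P; exists i0.
have [L LP] : exists L, 1 < kappa ^+ 2 * (1 + g / (4%:R * M)) ^+ L.+1.
  have q_gt0 : 0 < g / (4%:R * M) by rewrite divr_gt0 ?mulr_gt0.
  have [L hL] := unbounded_expr (kappa ^+ 2)^-1 q_gt0; exists L.
  rewrite mulrC -ltr_pdivrMr ?exprn_gt0 // mul1r; apply: lt_le_trans hL _.
  by rewrite ler_weXn2l // lerDl ltW.
(* Trapping begins by step [K1.+1], so the early steps [0, ..., K1.+1] number [K1.+2]. *)
exists C, (K1.+2 + L.+1 * (#|I| * #|I|))%N; split=> //.
move=> xs orb.
have [k0 k0K vk0] := orbit_small_variance M_ge1 spread orb d_gt0 K1P.
have [i near_i] : exists i, off_mass i (xs k0) <= eps.
  apply: (small_variance_off_mass g_gt0 gap i0).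
  by rewrite mulrC -ler_pdivlMr.
have g8v k : g ^+ 8 * variance lam (xs k) <= g ^+ 6 * variance lam (xs k).
  by rewrite ler_wpM2r ?variance_ge0 // ler_wiXn2l // ltW.
split=> [k Kk|s us hs].
  have k0k : (k0 <= k)%N.
    apply: leq_trans k0K (leq_trans _ (ltnW Kk)).
    by rewrite addSn ltnW // ltnS leq_addr.
  split.
    apply: le_lt_trans eps_C; rewrite ler_pM2l ?exprn_gt0 //.
    exact: (orbit_near_variance g_gt0 g_le1 M_ge1 spread gap eps_g2 orb near_i
             (leqW k0k)).
  have h := orbit_quadratic g_gt0 g_le1 M_ge1 spread gap eps_g2 orb near_i k0k.
  rewrite -(ler_pM2l g8_gt0); apply: le_trans (g8v _) (le_trans h _).
  set w := variance lam (xs k) ^+ 2; have w0 : 0 <= w by exact: sqr_ge0.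
  have h1 : g ^+ 8 * (C * w) <= g ^+ 8 * (C ^+ 2 * w).
    by rewrite ler_pM2l // ler_wpM2r.
  apply: le_trans h1; rewrite [leRHS]mulrA g8C.
  have : 0 <= M ^+ 4 * w by rewrite mulr_ge0 // exprn_ge0 // ltW.
  lra.
apply: (orbit_noncubic_count g_gt0 g_le1 M_ge1 spread gap ap_gap eps_g2 eps_g3
          orb near_i LP k0K us) => k /hs bad.
apply: le_lt_trans (_ : g ^+ 8 * (C ^+ 2 * variance lam (xs k) ^+ 3) < _).
  rewrite -g8C -mulrA ler_pM2l // ler_wpM2r // exprn_ge0 //.
  exact: variance_ge0.
by rewrite ltr_pM2l.
Qed.

(** * Spectral theorem for a simple spectrum *)

Lemma orthogonal_diagonalization (R : rcfType) m (T : 'M[R]_m) (lam : 'I_m -> R) :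
  T^T = T -> (forall i j, i != j -> lam i != lam j) ->
  (forall i, eigenvalue T (lam i)) ->
  exists P : 'M[R]_m,
    P *m P^T = 1%:M /\ P *m T = diag_mx (\row_i lam i) *m P.
Proof.
move=> symT inj ev.
have /fin_all_exists2[f fT f0] i := eigenvalueP (ev i).
pose dot i j := \sum_k f i 0 k * f j 0 k.
have dotE i j : dot i j = (f i *m (f j)^T) 0 0.
  by rewrite mxE; apply: eq_bigr => k _; rewrite !mxE.
have dot_neq i j : i != j -> dot i j = 0.
  move=> ij; have : lam i * dot i j = lam j * dot i j.
    transitivity ((f i *m T *m (f j)^T) 0 0).
      by rewrite fT -scalemxAl [RHS]mxE dotE.
    by rewrite -mulmxA -[X in X *m _^T]symT -trmx_mul fT linearZ /= -scalemxAr
         [LHS]mxE dotE.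
  move/eqP; rewrite -subr_eq0 -mulrBl mulf_eq0 subr_eq0 (negPf (inj _ _ ij)).
  by move/eqP.
have dot_gt0 i : 0 < dot i i.
  rewrite lt0r; apply/andP; split; last first.
    by apply: sumr_ge0 => k _; rewrite -expr2 sqr_ge0.
  apply: contraNneq (f0 i) => d0; apply/eqP/rowP => k; rewrite mxE.
  have /psumr_eq0P -/(_ _ k isT)/eqP : dot i i = 0 by [].
  by rewrite mulf_eq0 orbb => h; apply/eqP/h => l _; rewrite -expr2 sqr_ge0.
(* The rows are the normalized left eigenvectors, pairwise orthogonal since [T] is symmetric with
   distinct eigenvalues. *)
exists (\matrix_(i, j) (f i 0 j / Num.sqrt (dot i i))); split.
  apply/matrixP => i j; rewrite !mxE.
  transitivity (dot i j / (Num.sqrt (dot i i) * Num.sqrt (dot j j))).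
    rewrite mulr_suml; apply: eq_bigr => k _; rewrite !mxE invfM; ring.
  have [<-|ij] := eqVneq i j; last by rewrite dot_neq // mul0r.
  by rewrite -expr2 sqr_sqrtr ?divff ?gt_eqF // ltW.
rewrite mul_diag_mx; apply/matrixP => i j; rewrite !mxE.
have /rowP/(_ j) := fT i; rewrite !mxE mulrA => <-.
by rewrite mulr_suml; apply: eq_bigr => k _; rewrite !mxE mulrAC.
Qed.

(** * From QR steps on matrices to inverse iteration on coordinates *)

Section QRStep.
Variables (R : realType) (n : nat).
Local Notation M := 'M[R]_n.+2.
Local Notation lst := (Defs.lastI n).
Local Notation pn := (penI n).
Implicit Types (T Q Rm P : M) (lam : 'I_n.+2 -> R).

(** The trace of tridiagonality followed along the iteration: with symmetry, it puts [T e_N] in the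
    span of [e_N] and [e_{N-1}]. *)
Definition hessenberg_tail T := forall j, j != lst -> j != pn -> T lst j = 0.

Lemma val_penI : pn = n :> nat.
Proof. by rewrite /penI inordK. Qed.

Lemma penI_neq_last : pn != lst.
Proof. by rewrite -val_eqE /= val_penI neq_ltn ltnSn. Qed.

Lemma ltn_lastI (j : 'I_n.+2) : j != lst -> (j < lst)%N.
Proof. by rewrite -val_eqE => jl; rewrite ltn_neqAle jl -ltnS ltn_ord. Qed.

Lemma ltn_penI (j : 'I_n.+2) : j != lst -> j != pn -> (j < n)%N.
Proof.
move=> /ltn_lastI; rewrite -val_eqE /= val_penI ltnS => jn jp.
by rewrite ltn_neqAle jp.
Qed.

Lemma tridiagonal_tail T : tridiagonal T -> hessenberg_tail T.
Proof. by move=> tri j jl jp; apply: tri; rewrite /= !ltnS ltn_penI ?orbT. Qed.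

(** Relative to [T_{N,N}] the two eigenvalues of the block are [d + s] and [d - s], with product
    [- b ^+ 2]; the one of smaller modulus has square at most [b ^+ 2]. *)
Lemma wshift_is_shift T :
  (T pn pn - wshift T) * (T lst lst - wshift T) = subd T ^+ 2 /\
  (T lst lst - wshift T) ^+ 2 <= subd T ^+ 2.
Proof.
rewrite /wshift /subd; set a := T pn pn; set c := T lst lst; set b := T lst pn.
set d := (a - c) / 2%:R; set s := Num.sqrt _.
have s2 : s ^+ 2 = d ^+ 2 + b ^+ 2 by rewrite sqr_sqrtr // addr_ge0 ?sqr_ge0.
have mE : (a + c) / 2%:R = c + d by rewrite /d; field.
have aE : a = c + d *+ 2 by rewrite /d mulr2n; field.
rewrite mE.
have -> : c + d + s - c = d + s by ring.
have -> : c + d - s - c = d - s by ring.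
have prod : (d + s) ^+ 2 * (d - s) ^+ 2 = (b ^+ 2) ^+ 2.
  have -> : b ^+ 2 = s ^+ 2 - d ^+ 2 by rewrite s2; ring.
  by ring.
have small (p q : R) : p ^+ 2 * q ^+ 2 = (b ^+ 2) ^+ 2 -> `|p| <= `|q| ->
    p ^+ 2 <= b ^+ 2.
  move=> pq le_pq; rewrite -ler_sqr ?nnegrE ?sqr_ge0 // -pq expr2.
  by rewrite ler_wpM2l ?sqr_ge0 // -[leLHS]real_normK ?num_real //
     -[leRHS]real_normK ?num_real // ler_sqr ?nnegrE.
case: ltP => [/ltW|] h.
  split; first by rewrite {1}aE -[RHS](addrK (d ^+ 2)) [b ^+ 2 + _]addrC -s2; ring.
  have -> : c - (c + d + s) = - (d + s) by ring.
  by rewrite sqrrN; exact: small prod h.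
split; first by rewrite {1}aE -[RHS](addrK (d ^+ 2)) [b ^+ 2 + _]addrC -s2; ring.
have -> : c - (c + d - s) = - (d - s) by ring.
by rewrite sqrrN; apply: small h; rewrite mulrC.
Qed.

Section Coordinates.
Variables (lam : 'I_n.+2 -> R) (T P : M).
Hypotheses (symT : T^T = T) (tailT : hessenberg_tail T).
Hypotheses (PP : P *m P^T = 1%:M) (PT : P *m T = diag_mx (\row_i lam i) *m P).
Local Notation x := (fun i => P i lst).

Let PtP : P^T *m P = 1%:M. Proof. exact: mulmx1C. Qed.

Let dotP j k : \sum_i P i j * P i k = (j == k)%:R.
Proof.
have /matrixP/(_ j k) := PtP; rewrite !mxE => <-.
by apply: eq_bigr => i _; rewrite mxE.
Qed.

Let TE j k : T j k = \sum_i lam i * (P i j * P i k).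
Proof.
have -> : T = P^T *m (P *m T) by rewrite mulmxA PtP mul1mx.
rewrite PT mxE; apply: eq_bigr => i _.
by rewrite mul_diag_mx !mxE; ring.
Qed.

Lemma coord_unit : unit_norm x.
Proof.
transitivity (\sum_i P i lst * P i lst); last by rewrite dotP eqxx.
by apply: eq_bigr => i _; rewrite expr2.
Qed.

Lemma coord_mean : mean lam x = T lst lst.
Proof. by rewrite TE; apply: eq_bigr => i _; rewrite expr2. Qed.

(** Last column of [P T = Lambda P]. It identifies the residual of [x] with a multiple of the next
    column of [P], whence [coord_variance] and [coord_pen]. *)
Lemma coord_residual i : (lam i - T lst lst) * P i lst = subd T * P i pn.
Proof.
have /matrixP/(_ i lst) := PT; rewrite mul_diag_mx !mxE => h.
rewrite mulrBl -h (bigD1 lst) //= (bigD1 pn) /= ?penI_neq_last // big1.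
  by rewrite -{2}symT mxE addr0 /subd; ring.
move=> j /andP[jl jp]; rewrite -symT mxE tailT // ?mulr0 //.
Qed.

Lemma coord_variance : variance lam x = subd T ^+ 2.
Proof.
rewrite /variance coord_mean.
transitivity (subd T ^+ 2 * \sum_i P i pn * P i pn).
  by rewrite mulr_sumr; apply: eq_bigr => i _; rewrite -exprMn coord_residual; ring.
by rewrite dotP eqxx mulr1.
Qed.

Lemma coord_pen : subd T != 0 -> pen lam x = T pn pn.
Proof.
move=> b0; rewrite /pen coord_variance coord_mean.
apply: (mulIf (expf_neq0 2 b0)); rewrite divfK ?expf_neq0 // (TE pn pn) mulr_suml.
by apply: eq_bigr => i _; rewrite -exprMn coord_residual; ring.
Qed.

Lemma coord_is_shift : subd T != 0 -> is_shift lam x (wshift T).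
Proof.
move=> b0; rewrite /is_shift coord_pen // coord_mean coord_variance.
exact: wshift_is_shift.
Qed.

End Coordinates.

(** Common form of the generic and deflated cases: positivity is kept off the last diagonal
    entry. *)
Lemma wilkinson_step_qr T T' : wilkinson_step T T' -> exists Q Rm : M,
  [/\ orthogonal_mx Q, upper_triangular Rm,
      forall i, i != lst -> 0 < Rm i i,
      T - (wshift T)%:M = Q *m Rm & T' = Q^T *m T *m Q].
Proof.
by case=> _ [[_ [Q [Rm [? [? [Rp [? ?]]]]]]] | [_ [Q [Rm [? [? [Rp [? ?]]]]]]]];
  exists Q, Rm; split=> // i _; exact: Rp.
Qed.

Section Step.
Variables (T T' Q Rm : M) (w : R).
Hypotheses (symT : T^T = T) (tailT : hessenberg_tail T).
Hypotheses (orthQ : orthogonal_mx Q) (upR : upper_triangular Rm).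
Hypothesis posR : forall i, i != lst -> 0 < Rm i i.
Hypotheses (qr : T - w%:M = Q *m Rm) (T'E : T' = Q^T *m T *m Q).

(** Solve the last row of [T - w = Q R] from left to right by forward substitution. The bound on [m]
    avoids the last column, where [w] appears and [R] may have a zero diagonal entry. The case
    [m = n] preserves the tail, [m = n.+1] preserves deflation. *)
Lemma qr_last_row0 m : (m <= n.+1)%N ->
  (forall j : 'I_n.+2, (j < m)%N -> T lst j = 0) ->
  forall j : 'I_n.+2, (j < m)%N -> Q lst j = 0.
Proof.
move=> mn T0 [j jN] /=; elim/ltn_ind: j jN => j IH jN jm.
set J := Ordinal jN.
have Jl : J != lst by rewrite -val_eqE /= neq_ltn (leq_trans jm).
have /matrixP/(_ lst J) := qr; rewrite !mxE T0 // eq_sym (negPf Jl) mulr0n subrr.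
rewrite (bigD1 J) //= big1 => [|k kJ].
  by rewrite addr0 => /esym/eqP; rewrite mulf_eq0 (gt_eqF (posR Jl)) orbF => /eqP.
have [kj|jk|/val_inj kj] := ltngtP k J.
- case: k kj {kJ} => k kN /= kj; rewrite IH ?mul0r //.
  exact: ltn_trans kj jm.
- by rewrite upR ?mulr0.
- by rewrite kj eqxx in kJ.
Qed.

Lemma qr_step_sym : T'^T = T'.
Proof. by rewrite T'E !trmx_mul trmxK symT mulmxA. Qed.

Lemma qr_step_last_row j : j != lst -> T' lst j = Rm lst lst * Q lst j.
Proof.
move=> jl.
(* The last row of [Rm] is zero off the diagonal, so the last row of [T'] is read off from that of
   [Q]. *)
have -> : T' = Rm *m Q + w%:M.
  have -> : T' = Q^T *m (T - w%:M) *m Q + w%:M.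
    rewrite T'E mulmxBr mulmxBl [Q^T *m w%:M]scalar_mxC.
    by rewrite -[w%:M *m _ *m _]mulmxA orthQ mulmx1 subrK.
  by rewrite qr mulmxA orthQ mul1mx.
rewrite !mxE eq_sym (negPf jl) mulr0n addr0 (bigD1 lst) //= big1 ?addr0 // => k kl.
by rewrite upR ?mul0r ?ltn_lastI.
Qed.

Lemma qr_step_tail : hessenberg_tail T'.
Proof.
move=> j jl jp; rewrite qr_step_last_row // (@qr_last_row0 n) ?mulr0 ?ltn_penI //.
by move=> k kn; apply: tailT; rewrite -val_eqE /= ?val_penI neq_ltn ?kn // ltnW.
Qed.

Lemma qr_step_subd0 : subd T = 0 -> subd T' = 0.
Proof.
move=> b0; rewrite /subd qr_step_last_row ?penI_neq_last //.
rewrite (@qr_last_row0 n.+1) ?mulr0 ?val_penI // => k kn.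
have [->//|kp] := eqVneq k pn; apply: tailT => //.
by rewrite -val_eqE /= neq_ltn kn.
Qed.

(** By symmetry, transposing [T - w = Q R] gives [(T - w) Q = R^T], which is lower triangular; its
    last column says that [(T - w) Q e_N] is a multiple of [e_N]. *)
Lemma qr_step_inverse lam P : P *m T = diag_mx (\row_i lam i) *m P -> forall i,
  (lam i - w) * (P *m Q) i lst = Rm lst lst * P i lst.
Proof.
move=> PT i.
have AQ : (T - w%:M) *m Q = Rm^T.
  have -> : T - w%:M = (T - w%:M)^T by rewrite linearB /= symT tr_scalar_mx.
  by rewrite qr trmx_mul -mulmxA orthQ mulmx1.
have : (P *m (T - w%:M) *m Q) i lst = (P *m Rm^T) i lst by rewrite -mulmxA AQ.
rewrite [RHS]mxE (bigD1 lst) //= big1 => [|k kl]; last first.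
  by rewrite mxE upR ?mulr0 ?ltn_lastI.
rewrite addr0 [Rm^T _ _]mxE [RHS]mulrC => <-.
rewrite mulmxBr PT mulmxBl -[_ *m P *m Q]mulmxA.
rewrite mul_diag_mx mul_mx_scalar -scalemxAl !mxE.
by rewrite mulrBl.
Qed.

End Step.
End QRStep.

Theorem theorem3p4 (R : realType) (n : nat) (lam : 'I_n.+2 -> R) :
  (forall i j : 'I_n.+2, (i < j)%N -> lam i < lam j) ->
  ap_free lam ->
  exists (C : R) (K : nat), 0 < C /\ (0 < K)%N /\
    forall Ts : nat -> 'M[R]_n.+2,
      in_TLambda lam (Ts 0%N) ->
      (forall k, wilkinson_step (Ts k) (Ts k.+1)) ->
      (forall k : nat, (K < k)%N ->
          `|subd (Ts k.+1)| < C^-1 /\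
          `|subd (Ts k.+1)| <= C * `|subd (Ts k)| ^+ 2) /\
      (forall s : seq nat, uniq s ->
          (forall k, k \in s ->
             (0 < k)%N /\ `|subd (Ts k.+1)| > C * `|subd (Ts k)| ^+ 3) ->
          (size s <= K)%N).
Proof.
move=> lam_lt apf.
have inj i j : i != j -> lam i != lam j.
  rewrite -val_eqE neq_ltn => /orP[] /lam_lt h; first by rewrite lt_eqF.
  by rewrite gt_eqF.
have ap i j k : i != j -> i != k -> j != k -> lam i *+ 2 != lam j + lam k.
  move=> ij ik jk; apply: contraNneq (apf i j k ij ik jk) => e.
  by rewrite -e -(mulr_natr (lam i)) mulfK ?pnatr_eq0.
have [C [K [C_gt0 K_gt0 H]]] := orbit_asymptotics (Defs.lastI n) inj ap.
exists C, K; split=> //; split=> // Ts [sym0 [tri0 spec0]] steps.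
have [P0 [PP0 PT0]] := orthogonal_diagonalization sym0 inj
  (fun i => (spec0 (lam i)).2 (ex_intro _ i erefl)).
have [Q QP] := choice (fun k => wilkinson_step_qr (steps k)).
(* Accumulating the factors [Q] diagonalizes all iterates with the same ordering of the eigenvalues,
   so individual modes can be followed. *)
pose P := fix P k := if k is k'.+1 then P k' *m Q k' else P0.
have inv k : [/\ (Ts k)^T = Ts k, hessenberg_tail (Ts k), P k *m (P k)^T = 1%:M
               & P k *m Ts k = diag_mx (\row_i lam i) *m P k].
  elim: k => [|k [symk tailk PPk PTk]] /=.
    by split=> //; exact: tridiagonal_tail.
  have [Rm [oQ uR pR qr TE]] := QP k; split.
  - exact: qr_step_sym TE.
  - exact: qr_step_tail qr TE.
  - by rewrite trmx_mul mulmxA -(mulmxA (P k)) (mulmx1C oQ) mulmx1.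
  - by rewrite TE !mulmxA -(mulmxA (P k)) (mulmx1C oQ) mulmx1 PTk.
pose xs k i := P k i (Defs.lastI n).
have varE k : variance lam (xs k) = `|subd (Ts k)| ^+ 2.
  have [sy ta PP PT] := inv k.
  by rewrite real_normK ?num_real // -(coord_variance sy ta PP PT).
have orb : wilkinson_orbit lam xs.
  have unit k : unit_norm (xs k) by have [_ _ PP _] := inv k; exact: coord_unit.
  split=> // k; have [sy ta PP PT] := inv k; have [Rm [oQ uR pR qr TE]] := QP k.
  split=> [|vn0].
    rewrite !varE => /eqP; rewrite sqrf_eq0 normr_eq0 => /eqP b0.
    by rewrite (qr_step_subd0 ta oQ uR pR qr TE b0) normr0 expr0n.
  exists (wshift (Ts k)), (Rm (Defs.lastI n) (Defs.lastI n)); split=> //.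
    apply: coord_is_shift sy ta PP PT _.
    by move: vn0; rewrite varE sqrf_eq0 normr_eq0.
  by move=> i; exact: (qr_step_inverse sy oQ uR qr PT).
have [Ha Hb] := H xs orb.
split=> [k Kk|s us hs].
  have [h1 h2] := Ha k Kk; rewrite !varE in h1 h2; split.
    rewrite -(ltr_pM2l C_gt0) divff ?gt_eqF // -(@expr_lt1 _ 2) ?exprMn //.
    exact: mulr_ge0 (ltW C_gt0) (normr_ge0 _).
  rewrite -ler_sqr ?nnegrE ?exprMn //.
  exact: mulr_ge0 (ltW C_gt0) (exprn_ge0 _ (normr_ge0 _)).
apply: (Hb s us) => k /hs[_ bad]; rewrite !varE.
have -> : C ^+ 2 * (`|subd (Ts k)| ^+ 2) ^+ 3 =
  (C * `|subd (Ts k)| ^+ 3) ^+ 2 by ring.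
rewrite ltr_sqr ?nnegrE //.
exact: mulr_ge0 (ltW C_gt0) (exprn_ge0 _ (normr_ge0 _)).
Qed.
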